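(* Let $(\mathcal A,\varphi,\psi,B)$ be an operator-valued conditional probability space. For $x\in\mathcal A$ with $\varphi(x)=\psi(x)=1$, let $K_x,K^c_x$ be its series of free and conditionally free cumulants, let $T_x,T_x^c\in\mathbb C_0[[\mathrm{End}\,B]]$ be defined by $K_x=T_x\circ(I\cdot K_x)$, $K_x^c=T_x^c\circ(I\cdot K_x)$, put $E=\sum_{n\ge1}I^{n}$ (i.e. $E=\frac{I}{1-I}$, powers for the Cauchy product), and let $H_x,H_x^c\in\mathbb C_0[[\mathrm{End}\,B]]$ be defined by $$H_x=(T_x\circ E)\circ(I\cdot H_x),\qquad H^c_x=(T^c_x\circ E)\circ(I\cdot H_x).$$ Let $a,b\in\mathcal A$ be conditionally monotone independent (in this order) with $\varphi(a)=\psi(a)=1=\varphi(b)=\psi(b)$. Then $$H_{ba}=H_b\cdot\big(H_a\circ(I\cdot H_b)\big),\qquad H^c_{ba}=H^c_b\cdot\big(H^c_a\circ(I\cdot H_b)\big).$$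
   Context: Operator-valued conditional probability space $(\mathcal A,\varphi,\psi,B)$: a unital complex algebra $\mathcal A$ containing the unital algebra $B$ as a unital subalgebra, and two unital $B$-bimodule maps $\varphi,\psi\colon\mathcal A\to B$. Conditional monotone independence of $(a_1,a_2)$: let $\mathcal A_i=\langle a_i\rangle_0$ be the (non-unital) $B$-bimodule subalgebra generated by $a_i-1$, $i=1,2$. For all $p_j\in\mathcal A_{i_j}$ ($1\le j\le n$) with $i_j\ne i_{j+1}$: (i) monotone independence for $\psi$: if $i_j=2$ then $\psi(p_1\cdots p_n)=\psi(p_1\cdots p_{j-1}\,\psi(p_j)\,p_{j+1}\cdots p_n)$; (ii) $\varphi(p_1\cdots p_n)=\varphi(p_1)\varphi(p_2\cdots p_n)$ if $i_1=2$, and $\varphi(p_1\cdots p_n)=\varphi(p_1\cdots p_{n-1})\varphi(p_n)$ if $i_n=2$; (iii) if $2\le j\le n-1$ and $i_j=2$, then $\varphi(p_1\cdots p_n)=\varphi(p_1\cdots p_{j-1})(\varphi(p_j)-\psi(p_j))\varphi(p_{j+1}\cdots p_n)+\varphi(p_1\cdots p_{j-1}\psi(p_j)p_{j+1}\cdots p_n)$. In the theorem $a_1=a$, $a_2=b$. Multilinear series: $\mathbb C_0[[\mathrm{End}\,B]]$ is the set of $F=1+\sum_{n\ge1}F^{(n)}$ with $F^{(n)}\colon B^{\otimes n}\to B$ linear (degree-zero part $F^{(0)}=1\in B$), a group for the Cauchy product $(F\cdot G)^{(n)}(b_1,\dots,b_n)=\sum_{k=0}^nF^{(k)}(b_1,\dots,b_k)G^{(n-k)}(b_{k+1},\dots,b_n)$.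 The same product is used for series with arbitrary degree-zero part. $I$ is the series whose only nonzero component is $I^{(1)}=\mathrm{id}_B$. For a series $\alpha$ with $\alpha^{(0)}=0$, $(F\circ\alpha)^{(0)}=F^{(0)}$ and $(F\circ\alpha)^{(n)}=\sum_{k\ge1,\,q_1+\dots+q_k=n,\,q_i\ge1}F^{(k)}\circ(\alpha^{(q_1)}\otimes\cdots\otimes\alpha^{(q_k)})$. The displayed fixed-point equations have unique solutions. Cumulants of $x$ with $\varphi(x)=\psi(x)=1$: let $C^\varphi_x,C^\psi_x$ be the series with zero degree-zero part whose degree-$(n+1)$ component is $(b_0,\dots,b_n)\mapsto\varphi(b_0xb_1x\cdots xb_n)$, resp. $\psi(b_0xb_1x\cdots xb_n)$, $n\ge0$. Then $K_x,K^c_x\in\mathbb C_0[[\mathrm{End}\,B]]$ are the unique series with $C^\psi_x=I+I\cdot(K_x\circ C_x^\psi)\cdot C_x^\psi$ and $C^\varphi_x=I+I\cdot(K_x^c\circ C_x^\psi)\cdot C_x^\varphi$. *)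

(* Defs.v *)
From HB Require Import structures.
From mathcomp Require Import all_boot all_order all_algebra.
From mathcomp Require Import reals.
From mathcomp Require Export complex.

Set Implicit Arguments.
Unset Strict Implicit.
Unset Printing Implicit Defensive.

Import GRing.Theory.

Local Open Scope ring_scope.

Section MultilinearSeries.
Variables (K : comNzRingType) (B : algType K).

(* A sequence of maps F^(n) : B^n -> B (n >= 0) is encoded as a single function
   on finite sequences: F^(n)(b_1, ..., b_n) is F [:: b_1; ...; b_n], and the
   degree-zero part F^(0) is F [::].  Linearity of every F^(n) on the n-fold
   tensor power of B is the separate predicate [multilinear]. *)
Definition mseries : Type := seq B -> B.

Implicit Types F G alpha : mseries.

Definition multilinear F : Prop :=
  forall s1 s2 : seq B, linear (fun b : B => F (s1 ++ b :: s2)).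

(* C_0[[End B]] *)
Definition in_C0 F : Prop := multilinear F /\ F [::] = 1.

Definition sadd F G : mseries := fun s => F s + G s.

Definition cauchy F G : mseries :=
  fun s => \sum_(k < (size s).+1) F (take k s) * G (drop k s).

Definition sone : mseries := fun s => if s is [::] then 1 else 0.

Definition cauchy_pow F (k : nat) : mseries := iter k (cauchy F) sone.

(* The sum runs over all k and all compositions (q_1, ..., q_k) of n = size s
   with every q_i >= 1 (so k <= n and q_i <= n); reshape cuts s into consecutive
   blocks of lengths q_1, ..., q_k.  For n = 0 the only term is k = 0, which
   gives F^(0); for n >= 1 the term k = 0 is an empty sum. *)
Definition scomp F alpha : mseries := fun s =>
  \sum_(k < (size s).+1)
    \sum_(q : k.-tuple 'I_(size s).+1 |
            all (fun i => 0 < i)%N (map val q) && (sumn (map val q) == size s))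
      F (map alpha (reshape (map val q) s)).

Definition sI : mseries := fun s => if s is [:: b] then b else 0.

(* E = \sum_(k >= 1) I^k: since I^k is concentrated in degree k, only the terms
   k <= n contribute in degree n. *)
Definition sE : mseries := fun s =>
  \sum_(1 <= k < (size s).+1) cauchy_pow sI k s.

End MultilinearSeries.

Arguments sI {K B}.
Arguments sE {K B}.

Section ConditionalProbability.
Variables (K : comNzRingType) (A B : algType K).
(* The inclusion of B in A; it is required to be injective in the theorem. *)
Variable iota : {lrmorphism B -> A}.
Implicit Types (f phi psi : {linear A -> B}) (x a b : A).

Definition unital_bimodule_map f : Prop :=
  f 1 = 1 /\ forall (b : B) x (b' : B), f (iota b * x * iota b') = b * f x * b'.

(* The non-unital B-bimodule subalgebra of A generated by x. *)
Inductive bimod_alg x : A -> Prop :=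
| bimod_alg_gen : bimod_alg x x
| bimod_alg_lin (c : K) u v :
    bimod_alg x u -> bimod_alg x v -> bimod_alg x (c *: u + v)
| bimod_alg_mul u v : bimod_alg x u -> bimod_alg x v -> bimod_alg x (u * v)
| bimod_alg_act (b b' : B) u :
    bimod_alg x u -> bimod_alg x (iota b * u * iota b').

(* A word p_1 ... p_n is a list of pairs (i_j, p_j), where the index i_j is
   coded by false for 1 (letters from <a>_0) and true for 2 (from <b>_0). *)
Definition alternating_word a b (w : seq (bool * A)) : Prop :=
  sorted (fun u v : bool * A => u.1 != v.1) w /\
  {in w, forall u, bimod_alg (if u.1 then b - 1 else a - 1) u.2}.

Definition wprod (w : seq (bool * A)) : A := \prod_(u <- w) u.2.

Definition monotone_indep psi a b : Prop :=
  forall s p t, alternating_word a b (s ++ (true, p) :: t) ->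
    psi (wprod s * p * wprod t) = psi (wprod s * iota (psi p) * wprod t).

(* The boundary cases: for n = 1 both identities are trivial because the
   empty word has product 1 and phi 1 = 1. *)
Definition cmonotone_first phi a b : Prop :=
  forall p t, alternating_word a b ((true, p) :: t) ->
    phi (p * wprod t) = phi p * phi (wprod t).

Definition cmonotone_last phi a b : Prop :=
  forall s p, alternating_word a b (rcons s (true, p)) ->
    phi (wprod s * p) = phi (wprod s) * phi p.

Definition cmonotone_inner phi psi a b : Prop :=
  forall s p t, s != [::] -> t != [::] ->
    alternating_word a b (s ++ (true, p) :: t) ->
    phi (wprod s * p * wprod t) =
      phi (wprod s) * (phi p - psi p) * phi (wprod t)
      + phi (wprod s * iota (psi p) * wprod t).

Definition cmonotone_indep phi psi a b : Prop :=
  [/\ monotone_indep psi a b,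
      cmonotone_first phi a b,
      cmonotone_last phi a b
    & cmonotone_inner phi psi a b].

(* C^f_x, with C^(n+1)(b_0, ..., b_n) = f (b_0 x b_1 x ... x b_n). *)
Definition moment_series f x : mseries B := fun s =>
  if s is b0 :: s' then f (iota b0 * \prod_(b <- s') (x * iota b)) else 0.

Definition is_free_cumulants psi x (Kx : mseries B) : Prop :=
  let C := moment_series psi x in
  in_C0 Kx /\ C =1 sadd sI (cauchy sI (cauchy (scomp Kx C) C)).

Definition is_cfree_cumulants phi psi x (Kcx : mseries B) : Prop :=
  let Cphi := moment_series phi x in
  let Cpsi := moment_series psi x in
  in_C0 Kcx /\ Cphi =1 sadd sI (cauchy sI (cauchy (scomp Kcx Cpsi) Cphi)).

(* T (resp. T^c), from the cumulants: F = T o (I . K) with F = K (resp. K^c). *)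
Definition is_T_series (Kx F T : mseries B) : Prop :=
  in_C0 T /\ F =1 scomp T (cauchy sI Kx).

(* H = H_x is the case G = H of G = (T o E) o (I . H); H^c_x is G for T = T^c. *)
Definition is_H_series (Hx T G : mseries B) : Prop :=
  in_C0 G /\ G =1 scomp (scomp T sE) (cauchy sI Hx).

(* (Hx, Hcx) is the pair (H_x, H^c_x).  All the series involved are uniquely
   determined by the equations they satisfy. *)
Definition are_H_transforms phi psi x (Hx Hcx : mseries B) : Prop :=
  exists Kx Kcx Tx Tcx : mseries B,
    [/\ is_free_cumulants psi x Kx /\ is_cfree_cumulants phi psi x Kcx,
        is_T_series Kx Kx Tx /\ is_T_series Kx Kcx Tcx
      & is_H_series Hx Tx Hx /\ is_H_series Hx Tcx Hcx].

End ConditionalProbability.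

(* Main.v *)
From HB Require Import structures.
Require Import Defs.
From mathcomp Require Import all_boot all_order all_algebra.
From mathcomp Require Import boolp reals.

(* Work in the rings of formal series (functions on finite sequences of
   elements of B, with the Cauchy product).  Composing the defining equations
   with C = C^psi_x gives H_x = K_x o C and H^c_x = K^c_x o C, so that H_x and
   H^c_x are nothing but the Boolean cumulants: with W_x = (1 - I x)^-1 one has
   psi(W_x) = (1 - I H_x)^-1 and phi(W_x) = (1 - I H^c_x)^-1.
   Put a' = a - 1, V = W_b - 1, Z = psi(V) = (1 - I H_b)^-1 - 1 and
   S = (1 - Z a')^-1.  Then U = W_{ba} and Y = 1 + a' U satisfy U = 1 + V Y and
   U = S (1 + Z) + S (V - Z) Y.  Conditional monotone independence says that
   phi and psi both factorize at V - Z, and S (1 + Z) = (1 - I H_b a)^-1, whose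
   image under phi is (1 - I H_b eta)^-1 with eta = H^c_a o (I H_b).  Solving
   the resulting linear system gives phi(U) = (1 - I H^c_b eta)^-1; for psi the
   argument is the same. *)

Set Implicit Arguments.
Unset Strict Implicit.
Unset Printing Implicit Defensive.

Import GRing.Theory.

Local Open Scope ring_scope.

(** * The ring of series *)

Section Series.
Variables (T : Type) (A : pzRingType).

(** Letters and coefficients have separate types, because series in letters of [B] occur with values
    in [B] and in [A]. For [T = A = B] this is [mseries], and the product below is convertible to
    [cauchy]. *)
Definition ser : Type := seq T -> A.

HB.instance Definition _ := gen_eqMixin ser.
HB.instance Definition _ := gen_choiceMixin ser.

Implicit Types F G H X Y : ser.

Definition ser_add F G : ser := fun s => F s + G s.
Definition ser_opp F : ser := fun s => - F s.
Definition ser0 : ser := fun=> 0.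
Definition ser_mul F G : ser :=
  fun s => \sum_(k < (size s).+1) F (take k s) * G (drop k s).
Definition ser_cst (x : A) : ser := fun s => if s is [::] then x else 0.

Fact ser_addA : associative ser_add.
Proof. by move=> F G H; apply: funext => s; rewrite /ser_add addrA. Qed.
Fact ser_addC : commutative ser_add.
Proof. by move=> F G; apply: funext => s; rewrite /ser_add addrC. Qed.
Fact ser_add0 : left_id ser0 ser_add.
Proof. by move=> F; apply: funext => s; rewrite /ser_add add0r. Qed.
Fact ser_addN : left_inverse ser0 ser_opp ser_add.
Proof. by move=> F; apply: funext => s; rewrite /ser_add addNr. Qed.

HB.instance Definition _ :=
  GRing.isZmodule.Build ser ser_addA ser_addC ser_add0 ser_addN.

(** Fixing the first argument drives the inductions on the argument list. *)
Definition shift F b : ser := fun s => F (b :: s).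

Lemma ser_mul_nil F G : ser_mul F G [::] = F [::] * G [::].
Proof. by rewrite /ser_mul big_ord1. Qed.

Lemma ser_mul_cons F G b s :
  ser_mul F G (b :: s) = F [::] * G (b :: s) + ser_mul (shift F b) G s.
Proof. by rewrite /ser_mul big_ord_recl. Qed.

Fact ser_mulDl : left_distributive ser_mul ser_add.
Proof.
move=> F G H; apply: funext => s; rewrite /ser_mul /ser_add -big_split.
by apply: eq_bigr => k _; rewrite mulrDl.
Qed.

Fact ser_mulDr : right_distributive ser_mul ser_add.
Proof.
move=> F G H; apply: funext => s; rewrite /ser_mul /ser_add -big_split.
by apply: eq_bigr => k _; rewrite mulrDr.
Qed.

Fact ser_mul1 : left_id (ser_cst 1) ser_mul.
Proof.
move=> F; apply: funext => s.
rewrite /ser_mul big_ord_recl take0 drop0 mul1r big1 ?addr0 // => k _.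
by case: s k => [|b s] k; [case: k | rewrite mul0r].
Qed.

Fact ser_mulr1 : right_id (ser_cst 1) ser_mul.
Proof.
move=> F; apply: funext => s.
rewrite /ser_mul big_ord_recr /= take_size drop_size mulr1 big1 ?add0r // => k _.
case: (drop k s) (size_drop k s) => [|? ? _]; last by rewrite mulr0.
by move=> /esym/eqP; rewrite subn_eq0 leqNgt ltn_ord.
Qed.

Lemma ser_mul_cst x F s : ser_mul (ser_cst x) F s = x * F s.
Proof.
rewrite /ser_mul big_ord_recl take0 drop0 big1 ?addr0 // => k _.
by case: s k => [|b s] k; [case: k | rewrite mul0r].
Qed.

Fact ser_mulA : associative ser_mul.
Proof.
move=> F G H; apply: funext => s; elim: s F G => [|b s IHs] F G.
  by rewrite !ser_mul_nil mulrA.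
rewrite !ser_mul_cons IHs ser_mul_nil mulrDr mulrA -addrA; congr (_ + _).
(* A Leibniz rule: the first argument goes to [G] if [F] receives nothing, and to [F] otherwise. *)
have -> : shift (ser_mul F G) b =
    ser_add (ser_mul (ser_cst (F [::])) (shift G b)) (ser_mul (shift F b) G).
  by apply: funext => t; rewrite /shift ser_mul_cons /ser_add ser_mul_cst.
by rewrite ser_mulDl /ser_add -!IHs ser_mul_cst.
Qed.

HB.instance Definition _ := GRing.Zmodule_isPzRing.Build ser
  ser_mulA ser_mul1 ser_mulr1 ser_mulDl ser_mulDr.

Lemma serD F G s : (F + G) s = F s + G s. Proof. by []. Qed.
Lemma serB F G s : (F - G) s = F s - G s. Proof. by []. Qed.
Lemma ser1E s : (1 : ser) s = if s is [::] then 1 else 0. Proof. by []. Qed.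
Lemma serM F G s :
  (F * G) s = \sum_(k < (size s).+1) F (take k s) * G (drop k s).
Proof. by []. Qed.
Lemma serM_nil F G : (F * G) [::] = F [::] * G [::].
Proof. exact: ser_mul_nil. Qed.
Lemma serM_cons F G b s :
  (F * G) (b :: s) = F [::] * G (b :: s) + (shift F b * G : ser) s.
Proof. exact: ser_mul_cons. Qed.

Lemma ser_sum (I : Type) (r : seq I) (P : pred I) (F : I -> ser) s :
  (\sum_(i <- r | P i) F i) s = \sum_(i <- r | P i) F i s.
Proof. by elim/big_rec2: _ => // i x y _ <-. Qed.

Lemma ser_cstMl x F s : (ser_cst x * F) s = x * F s.
Proof. exact: ser_mul_cst. Qed.

Lemma ser_cstM x y : ser_cst (x * y) = ser_cst x * ser_cst y.
Proof.
by apply: funext => -[|b s]; rewrite ser_cstMl //= mulr0.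
Qed.

Lemma ser_cstB1 x : ser_cst (x - 1) = ser_cst x - 1.
Proof. by apply: funext => -[|b s]; rewrite ?serB //= ?subr0. Qed.

Lemma eq_serM F F' G G' s :
    (forall t, size t <= size s -> F t = F' t)%N ->
    (forall t, size t <= size s -> G t = G' t)%N ->
  (F * G) s = (F' * G') s.
Proof.
move=> eqF eqG; rewrite !serM; apply: eq_bigr => k _.
by rewrite eqF ?size_take_min ?geq_minr // eqG // size_drop leq_subr.
Qed.

(** Without a constant term, each of the [n] factors must consume at least one argument. *)
Lemma serX_small F n s : F [::] = 0 -> (size s < n)%N -> (F ^+ n) s = 0.
Proof.
move=> F0; elim: n s => // n IHn s ltsn.
rewrite exprS serM big1 // => -[[|k] lekn] _ /=; first by rewrite take0 F0 mul0r.
rewrite IHn ?mulr0 // size_drop; move: lekn ltsn.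
by case: (size s) => // m _; rewrite subSS !ltnS; apply/leq_trans/leq_subr.
Qed.

(** Neumann series in [D = 1 - X]. In degree n only the powers of [D] up to n contribute, so
    truncating at an order that depends on the argument list loses nothing. *)
Lemma ser_right_inverse X : X [::] = 1 -> {Y | X * Y = 1}.
Proof.
move=> X1; pose D := 1 - X.
have D0 : D [::] = 0 by rewrite /D serB X1 ser1E subrr.
pose P n := \sum_(k < n) D ^+ k.
have PE n s : (size s < n)%N -> P n s = P (size s).+1 s.
  move=> ltsn; rewrite /P -(subnKC ltsn) big_split_ord /= serD.
  rewrite [X in _ + X]ser_sum [X in _ + X]big1 ?addr0 // => k _.
  by rewrite serX_small // ltnS leq_addr.
exists (fun s => P (size s).+1 s); apply: funext => s.
transitivity ((X * P (size s).+1) s).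
  by apply: eq_serM => // t lets; rewrite [RHS]PE.
have -> : X * P (size s).+1 = 1 - D ^+ (size s).+1.
  by rewrite -[RHS]opprB subrX1 -mulNr opprB /D subKr.
by rewrite serB serX_small // subr0.
Qed.

(** [Y] also has constant term 1, hence a right inverse of its own, which must be [X]. *)
Lemma ser_invC X Y : X [::] = 1 -> X * Y = 1 -> Y * X = 1.
Proof.
move=> X1 XY; have Y1 : Y [::] = 1.
  by move/(congr1 (fun F : ser => F [::])): XY; rewrite serM_nil X1 mul1r.
have [Z YZ] := ser_right_inverse Y1.
by have -> : X = Z by rewrite -(mulr1 X) -YZ mulrA XY mul1r.
Qed.

Lemma ser_mulIl X F G : X [::] = 1 -> X * F = X * G -> F = G.
Proof.
move=> X1 eqXFG; have [Y XY] := ser_right_inverse X1.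
have YX := ser_invC X1 XY.
by rewrite -(mul1r F) -YX -mulrA eqXFG mulrA YX mul1r.
Qed.

Lemma ser_mulIr X F G : X [::] = 1 -> F * X = G * X -> F = G.
Proof.
move=> X1 eqFGX; have [Y XY] := ser_right_inverse X1.
by rewrite -(mulr1 F) -XY mulrA eqFGX -mulrA XY mulr1.
Qed.

Lemma ser_fixpoint_unique X Y F G :
  X [::] = 0 -> F = Y + X * F -> G = Y + X * G -> F = G.
Proof.
move=> X0 eqF eqG; apply: (@ser_mulIl (1 - X)).
  by rewrite serB X0 subr0 ser1E.
by rewrite !mulrBl !mul1r {1}eqF {1}eqG !addrK.
Qed.

End Series.

(** * Composition of series *)

Section Splittings.
Variable T : Type.
Implicit Types (s : seq T) (p : seq (seq T)).

(* The lists of nonempty blocks with concatenation s. *)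
Fixpoint splits s : seq (seq (seq T)) :=
  if s is b :: s' then
    [seq [:: b] :: p | p <- splits s'] ++
    [seq (b :: head [::] p) :: behead p | p <- splits s' & ~~ nilp p]
  else [:: [::]].

Variable V : nmodType.

(** The new letter either forms a block alone or joins the first block, if there is one. *)
Lemma big_splits_cons (Phi : seq (seq T) -> V) b s :
  \sum_(p <- splits (b :: s)) Phi p =
  \sum_(p <- splits s)
    (Phi ([:: b] :: p) +
     (if p is h :: t then Phi ((b :: h) :: t) else 0)).
Proof.
rewrite /= big_cat /= !big_map big_filter big_split /=; congr (_ + _).
by rewrite big_mkcond; apply: eq_bigr => -[].
Qed.

(** Cutting between two blocks amounts to cutting the word first and then splitting both halves.
    Multiplicativity and associativity of composition rest on this exchange. *)
Lemma big_splits_cut (Phi : seq (seq T) -> seq (seq T) -> V) s :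
  \sum_(p <- splits s) \sum_(k < (size p).+1) Phi (take k p) (drop k p) =
  \sum_(j < (size s).+1)
    \sum_(p1 <- splits (take j s)) \sum_(p2 <- splits (drop j s)) Phi p1 p2.
Proof.
elim: s Phi => [|b s IHs] Phi; first by rewrite /= !(big_seq1, big_ord1).
rewrite [RHS]big_ord_recl take0 drop0 big_seq1.
pose Psi p1 p2 := Phi ([:: b] :: p1) p2 +
  (if p1 is h :: t then Phi ((b :: h) :: t) p2 else 0).
have -> : \sum_(i < size (b :: s)) \sum_(p1 <- splits (take (lift ord0 i) (b :: s)))
      \sum_(p2 <- splits (drop (lift ord0 i) (b :: s))) Phi p1 p2 =
    \sum_(p <- splits s) \sum_(k < (size p).+1) Psi (take k p) (drop k p).
  rewrite IHs; apply: eq_bigr => k _; rewrite [LHS]big_splits_cons.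
  apply: eq_bigr => p1 _; rewrite big_split; congr (_ + _).
  by case: p1 => //; rewrite big1.
rewrite !big_splits_cons -big_split; apply: eq_bigr => p _ /=.
rewrite big_ord_recl take0 drop0 -!addrA; congr (_ + _).
rewrite [in RHS]big_split /= addrCA; congr (_ + _).
case: p => [|h t]; first by rewrite big_ord1 addr0.
by rewrite big_ord_recl take0 drop0; congr (_ + _); rewrite [RHS]big_ord_recl add0r.
Qed.

Lemma big_splits_first (Phi : seq (seq T) -> V) b s :
  \sum_(p <- splits (b :: s)) Phi p =
  \sum_(j < (size s).+1)
    \sum_(p <- splits (drop j s)) Phi ((b :: take j s) :: p).
Proof.
elim: s b Phi => [|c s IHs] b Phi; first by rewrite big_ord1 !big_seq1.
rewrite big_splits_cons big_split /= [RHS]big_ord_recl /=; congr (_ + _).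
pose Psi p := if p is h :: t then Phi ((b :: h) :: t) else 0.
by rewrite (IHs c Psi).
Qed.

End Splittings.

Lemma mem_splits (T : eqType) (s : seq T) p :
  (p \in splits s) = (flatten p == s) && all (fun h => ~~ nilp h) p.
Proof.
elim: s p => [|b s IHs] p.
  by rewrite inE; case: p => // -[|x h] p //=; rewrite andbF.
rewrite mem_cat; apply/orP/andP => [[/mapP[q]|/mapP[q]]|[]].
- by rewrite IHs => /andP[/eqP <- nzq] ->.
- rewrite mem_filter IHs => /and3P[+ /eqP <- nzq] ->.
  by case: q nzq => //= h q /andP[].
case: p => [|[|c [|d h]] p] //=; rewrite ?andbF // eqseq_cons.
  move=> /andP[/eqP-> /eqP eqs] nzp; left; apply/mapP; exists p => //.
  by rewrite IHs eqs eqxx.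
move=> /andP[/eqP-> /eqP eqs] nzp; right; apply/mapP; exists ((d :: h) :: p) => //.
by rewrite mem_filter IHs -eqs /= eqxx.
Qed.

Lemma splits_uniq (T : eqType) (s : seq T) : uniq (splits s).
Proof.
elim: s => //= b s IHs; rewrite cat_uniq !map_inj_in_uniq ?filter_uniq //.
- rewrite IHs !andbT; apply/hasPn => p /mapP[q].
  rewrite mem_filter mem_splits => /and3P[nzq _ hq] ->; apply/mapP => -[r _].
  by case: q nzq hq => // -[].
- move=> p q; rewrite !mem_filter => /andP[+ _] /andP[+ _].
  by case: p; case: q => //= ? ? ? ? _ _ [-> ->].
by move=> p q _ _ [].
Qed.

Section Composition.
Variables (T U : Type) (A : pzRingType).
Implicit Types (F G : ser U A) (alpha : seq T -> U).

(** This is [scomp] with compositions of the length replaced by lists of blocks, which allow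
    recursion on the word. *)
Definition ser_comp F alpha : ser T A :=
  fun s => \sum_(p <- splits s) F (map alpha p).

Lemma ser_compD F G alpha :
  ser_comp (F + G) alpha = ser_comp F alpha + ser_comp G alpha.
Proof. by apply: funext => s; rewrite /ser_comp serD -big_split. Qed.

Lemma ser_comp_nil F alpha : ser_comp F alpha [::] = F [::].
Proof. by rewrite /ser_comp big_seq1. Qed.

Lemma ser_comp_cons F alpha b s :
  ser_comp F alpha (b :: s) =
  \sum_(j < (size s).+1) ser_comp (shift F (alpha (b :: take j s))) alpha (drop j s).
Proof. exact: big_splits_first. Qed.

Lemma ser_comp_cst (x : A) alpha : ser_comp (ser_cst x : ser U A) alpha = ser_cst x.
Proof.
apply: funext => -[|b s]; first by rewrite ser_comp_nil.
by rewrite ser_comp_cons big1 // => j _; rewrite /ser_comp big1.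
Qed.

Lemma ser_comp1 alpha : ser_comp 1 alpha = 1.
Proof. exact: ser_comp_cst. Qed.

(** With [ser_compD] and [ser_comp1], substitution of a fixed inner series is a ring morphism in the
    outer one. *)
Lemma ser_compM F G alpha :
  ser_comp (F * G) alpha = ser_comp F alpha * ser_comp G alpha.
Proof.
apply: funext => s; pose Phi p1 p2 := F (map alpha p1) * G (map alpha p2).
rewrite /ser_comp serM.
transitivity (\sum_(p <- splits s) \sum_(k < (size p).+1)
    Phi (take k p) (drop k p)).
  apply: eq_bigr => p _; rewrite serM size_map; apply: eq_bigr => k _.
  by rewrite /Phi map_take map_drop.
rewrite big_splits_cut; apply: eq_bigr => j _; rewrite mulr_suml.
by apply: eq_bigr => p1 _; rewrite mulr_sumr.
Qed.

Lemma eq_ser_comp F alpha beta s :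
    (forall t, size t <= size s -> alpha t = beta t)%N ->
  ser_comp F alpha s = ser_comp F beta s.
Proof.
have [n] := ubnP (size s); elim: n s F => // n IHn [|b s] F.
  by rewrite !ser_comp_nil.
rewrite ltnS => lesn eqab; rewrite !ser_comp_cons; apply: eq_bigr => j _.
have ledj : (size (drop j s) <= size s)%N by rewrite size_drop leq_subr.
rewrite eqab; last by rewrite /= ltnS size_take_min geq_minr.
apply: IHn => [|t letj]; first exact: leq_ltn_trans ledj lesn.
exact/eqab/leqW/(leq_trans letj).
Qed.

End Composition.

(** * Agreement with [scomp], and associativity of composition *)

Section MultilinearSeries.
Variables (K : comNzRingType) (B : algType K).
Implicit Types F G alpha beta : mseries B.

Lemma cauchyE F G : cauchy F G = (F : ser B B) * G.
Proof. by []. Qed.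

Lemma scompE F alpha : scomp F alpha = ser_comp (F : ser B B) alpha.
Proof.
apply: funext => s; rewrite /scomp /ser_comp.
transitivity (\sum_(k < (size s).+1) \sum_(p <- splits s | size p == k)
    F (map alpha p)).
  apply: eq_bigr => k _; set P := BIG_P.
  pose code (q : k.-tuple 'I_(size s).+1) := map val q.
  have code_inj : injective code by move=> q r /(inj_map val_inj)/val_inj.
  rewrite -[RHS]big_filter -big_filter.
  pose G q := F (map alpha (reshape q s)).
  rewrite -(big_map code xpredT G).
  (* [shape] and [reshape] are inverse bijections between block lists of [s] and compositions of its
     length. *)
  transitivity (\sum_(q <- map shape [seq p <- splits s | size p == k]) G q).
    apply: perm_big; apply: uniq_perm.
    - by rewrite map_inj_uniq // filter_uniq // index_enum_uniq.
    - rewrite map_inj_in_uniq ?filter_uniq ?splits_uniq // => p r.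
      rewrite !mem_filter !mem_splits => /and3P[_ /eqP eqp _] /and3P[_ /eqP eqr _].
      by move=> eqsh; rewrite -(flattenK p) -(flattenK r) eqp eqr eqsh.
    move=> q; apply/mapP/mapP => [[r]|[p]].
      rewrite mem_filter => /andP[/andP[/allP posr /eqP sumr] _ ->].
      have shr : shape (reshape (code r) s) = code r.
        by apply: reshapeKl; rewrite sumr.
      exists (reshape (code r) s); last by rewrite shr.
      rewrite mem_filter mem_splits reshapeKr ?sumr // eqxx.
      rewrite -(size_map size) -/(shape _) shr size_map size_tuple eqxx /=.
      apply/allP => h /(map_f size); rewrite -/(shape _) shr => /posr.
      by rewrite /nilp lt0n.
    rewrite mem_filter mem_splits => /and3P[/eqP szp /eqP eqs nzp] ->.
    have szh h : h \in p -> (size h < (size s).+1)%N.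
      move=> hp; rewrite ltnS -eqs size_flatten sumnE.
      by rewrite (big_rem (size h)) ?leq_addr ?map_f.
    have szr : size [seq inord (size h) : 'I_(size s).+1 | h <- p] == k.
      by rewrite size_map szp.
    have coder : code (Tuple szr) = shape p.
      rewrite /code -map_comp; apply/eq_in_map => h /szh ltsz.
      by rewrite /= inordK.
    exists (Tuple szr) => //; rewrite mem_filter mem_index_enum andbT /P.
    rewrite -/(code _) coder -size_flatten eqs eqxx andbT.
    by apply/allP => _ /mapP[h /(allP nzp) + ->]; rewrite lt0n.
  rewrite big_map !big_filter big_seq_cond [RHS]big_seq_cond.
  apply: eq_bigr => p /andP[]; rewrite mem_splits => /andP[/eqP eqs _] _.
  by rewrite /G -eqs flattenK.
rewrite (exchange_big_dep xpredT) //= big_seq [RHS]big_seq.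
apply: eq_bigr => p; rewrite mem_splits => /andP[/eqP eqs nzp].
have ltp : (size p < (size s).+1)%N.
  rewrite ltnS -eqs size_flatten; elim: p nzp {eqs} => //= h p IHp /andP[nzh nzp].
  by rewrite -[(size p).+1]add1n leq_add ?IHp // lt0n.
by rewrite (big_pred1 (Ordinal ltp)) // => k; rewrite eq_sym.
Qed.

Lemma multilinear_shift F b : multilinear F -> multilinear (shift (F : ser B B) b).
Proof. by move=> Fl s1 s2; apply: (Fl (b :: s1)). Qed.

Lemma multilinear_sum (I : Type) (r : seq I) (c : I -> B) F s : multilinear F ->
  F ((\sum_(i <- r) c i) :: s) = \sum_(i <- r) F (c i :: s).
Proof.
move=> /(_ [::] s) /= Fl.
have F0 : F (0 :: s) = 0.
  by have := Fl (-1) 0 0; rewrite scaler0 addr0 scaleN1r addNr.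
elim: r => [|i r IHr]; first by rewrite !big_nil.
by have := Fl 1 (c i) (\sum_(j <- r) c j); rewrite !scale1r !big_cons => ->; rewrite IHr.
Qed.

(** Both sides sum over two-level splittings. On the right an inner sum sits inside an argument of
    [F], and multilinearity pulls it out. The induction generalizes [F], since removing the first
    outer block replaces it by a shift. *)
Lemma ser_compA F alpha beta : multilinear F ->
  ser_comp (ser_comp (F : ser B B) alpha : ser B B) beta =
  ser_comp (F : ser B B) (ser_comp (alpha : ser B B) beta).
Proof.
move=> Fl; apply: funext => s.
have [n] := ubnP (size s); elim: n s F Fl => // n IHn [|b s] F Fl.
  by rewrite !ser_comp_nil.
rewrite ltnS => lesn; rewrite [RHS]ser_comp_cons.
(* [p1] collects the fine blocks inside the first coarse block. The value 0 at the empty list lets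
   the sum run over all cuts, as [big_splits_cut] requires. *)
pose Phi p1 p2 := if p1 is [::] then 0 else
  ser_comp (shift (F : ser B B) (alpha (map beta p1))) alpha (map beta p2).
transitivity (\sum_(p <- splits (b :: s)) \sum_(k < (size p).+1)
    Phi (take k p) (drop k p)).
  rewrite /ser_comp big_seq [RHS]big_seq; apply: eq_bigr => -[|h p].
    by rewrite mem_splits.
  move=> _; rewrite big_ord_recl take0 add0r [LHS]ser_comp_cons size_map.
  by apply: eq_bigr => k _ /=; rewrite -map_take -map_drop.
rewrite big_splits_cut big_ord_recl take0 big_seq1 big1 // add0r.
apply: eq_bigr => j _ /=.
rewrite -IHn; first 1 last.
- exact: multilinear_shift.
- by apply: leq_ltn_trans lesn; rewrite size_drop leq_subr.
rewrite /= {2}/ser_comp.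
rewrite [RHS](_ : _ = \sum_(p1 <- splits (b :: take j s))
    ser_comp (ser_comp (shift (F : ser B B) (alpha (map beta p1))) alpha : ser B B) beta
      (drop j s)).
  by rewrite /= big_seq [RHS]big_seq; apply: eq_bigr => -[];
     rewrite ?(mem_splits (b :: _)).
rewrite /ser_comp exchange_big /=; apply: eq_bigr => p2 _.
rewrite exchange_big /=; apply: eq_bigr => p3 _; rewrite /shift.
exact: multilinear_sum.
Qed.

End MultilinearSeries.

(** * Cumulants and moments *)

Section Identity.
Variables (K : comNzRingType) (B : algType K).
Implicit Types F G alpha : ser B B.

Definition id_ser : ser B B := sI.
Local Notation I := id_ser.

Lemma id_serM_nil F : (I * F) [::] = 0.
Proof. by rewrite serM_nil mul0r. Qed.

Lemma id_serM_cons F b s : (I * F) (b :: s) = b * F s.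
Proof.
rewrite serM_cons mul0r add0r.
have -> : shift I b = ser_cst b by apply: funext => -[].
by rewrite ser_cstMl.
Qed.

Lemma mul_id_ser_rcons F s b : (F * I) (rcons s b) = F s * b.
Proof.
rewrite serM size_rcons big_ord_recr big_ord_recr /=.
rewrite -(size_rcons s b) drop_size mulr0 addr0 -cats1 take_size_cat //.
rewrite drop_size_cat // big1 ?add0r // => k _.
have := size_drop k (s ++ [:: b]); rewrite size_cat /= addn1 subSn; last exact/ltnW.
case: (drop _ _) => [|c [|d t]] //=; last by rewrite mulr0.
by case=> /esym/eqP; rewrite subn_eq0 leqNgt ltn_ord.
Qed.

(** [I] has no constant term, so it is not invertible, but feeding it the argument 1 recovers the
    other factor. *)
Lemma id_ser_mulIl F G : I * F = I * G -> F = G.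
Proof.
move=> eqFG; apply: funext => s.
by have := congr1 (fun X : ser B B => X (1 :: s)) eqFG; rewrite !id_serM_cons !mul1r.
Qed.

Lemma id_ser_mulIr F G : F * I = G * I -> F = G.
Proof.
move=> eqFG; apply: funext => s.
have := congr1 (fun X : ser B B => X (rcons s 1)) eqFG.
by rewrite !mul_id_ser_rcons !mulr1.
Qed.

Lemma ser_comp_id_ser alpha : alpha [::] = 0 -> ser_comp I alpha = alpha.
Proof.
move=> alpha0; apply: funext => -[|b s]; first by rewrite ser_comp_nil.
rewrite ser_comp_cons.
have sh c : shift I c = ser_cst c by apply: funext => -[].
under eq_bigr => j _ do rewrite sh ser_comp_cst.
rewrite big_ord_recr /= take_size drop_size big1 ?add0r // => j _.
case: (drop _ _) (size_drop j s) => //= /esym/eqP.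
by rewrite subn_eq0 leqNgt ltn_ord.
Qed.

(** In every positive degree exactly one power of [I] survives, so [sE] multiplies its arguments. *)
Lemma sE_fix : (sE : ser B B) = I + I * sE.
Proof.
have powE k s : cauchy_pow (sI : mseries B) k s =
    if size s == k then \prod_(b <- s) b else 0.
  elim: k s => [|k IHk] s; first by case: s => //=; rewrite big_nil.
  rewrite /cauchy_pow iterS -/(cauchy_pow _ _) cauchyE.
  case: s => [|b s]; first exact: id_serM_nil.
  by rewrite id_serM_cons IHk eqSS big_cons; case: eqP; rewrite ?mulr0.
have sEE s : (sE : mseries B) s = if s is [::] then 0 else \prod_(b <- s) b.
  rewrite /sE (eq_bigr _ (fun k _ => powE k s)).
  case: s => [|b s]; first by rewrite big_geq.
  rewrite big_nat_recr //= eqxx big_nat_cond big1 ?add0r // => k.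
  by rewrite andbT ltnS => /andP[_ lek]; case: eqP lek => // <-; rewrite ltnn.
apply: funext => -[|b s]; rewrite serD ?id_serM_nil ?id_serM_cons sEE ?addr0 //.
rewrite sEE; case: s => [|c s]; first by rewrite big_seq1 mulr0 addr0.
by rewrite add0r big_cons.
Qed.

(** The factor [I] consumes an argument, so the right side in degree n only involves [G] in degrees
    below n. *)
Lemma ser_comp_fix_unique (F G G' : ser B B) :
  G = ser_comp F (I * G) -> G' = ser_comp F (I * G') -> G = G'.
Proof.
move=> eqG eqG'; apply: funext => s; have [n] := ubnP (size s).
elim: n s => // n IHn s; rewrite ltnS => lesn.
rewrite eqG eqG'; apply: eq_ser_comp => -[|b t]; first by rewrite !id_serM_nil.
by move=> lets; rewrite !id_serM_cons IHn // (leq_trans lets).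
Qed.

(* Since [C = I + I kappa C] with [kappa = Kx o C] gives
   [C kappa = E o (I kappa)], the equation [Kx = T o (I Kx)] composed with [C]
   says that [kappa] solves the fixed-point equation of [Hx]. *)
Lemma H_series_cumulants (C Kx T Hx F Tc G : mseries B) :
    (C : ser B B) = I + I * (ser_comp (Kx : ser B B) C * (C : ser B B)) ->
    is_T_series Kx Kx T -> is_T_series Kx F Tc ->
    is_H_series Hx T Hx -> is_H_series Hx Tc G ->
  G = ser_comp (F : ser B B) C.
Proof.
move=> eqC [[Tl _] eqK] [[Tcl _] eqF] [_ eqH] [_ eqG].
set kappa := ser_comp (Kx : ser B B) C in eqC.
have C0 : C [::] = 0 by rewrite [C in LHS]eqC serD id_serM_nil addr0.
have compIK : ser_comp ((I : ser B B) * (Kx : ser B B)) C = (C : ser B B) * kappa.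
  by rewrite ser_compM ser_comp_id_ser.
(* Both sides solve [X = I * kappa + I * kappa * X]. *)
have compE : ser_comp (sE : ser B B) (I * kappa) = (C : ser B B) * kappa.
  apply: (@ser_fixpoint_unique _ _ (I * kappa) (I * kappa)).
  - exact: id_serM_nil.
  - rewrite [in LHS]sE_fix ser_compD ser_compM ser_comp_id_ser //; exact: id_serM_nil.
  - by rewrite {1}eqC mulrDl !mulrA.
(* Composing with [C] turns [I * Kx] into [C * kappa], which is [E] composed with [I * kappa]; this
   serves both [T] and [Tc]. *)
have Tcomp (S X : mseries B) : multilinear S -> X =1 scomp S (cauchy sI Kx) ->
    ser_comp (X : ser B B) C = ser_comp (ser_comp (S : ser B B) sE) (I * kappa).
  move=> Sl /funext ->; rewrite scompE ser_compA //.
  by rewrite [X in ser_comp _ X = _]compIK ser_compA // compE.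
have HE : (Hx : ser B B) = kappa.
  apply: (ser_comp_fix_unique (F := ser_comp (T : ser B B) sE)); last exact: Tcomp.
  by rewrite [LHS](funext eqH) !scompE.
by rewrite (Tcomp Tc F) // [LHS](funext eqG) !scompE -HE.
Qed.

End Identity.

(** * Moment series as images of geometric series *)

Section Moments.
Variables (K : comNzRingType) (A B : algType K).
Variable iota : {lrmorphism B -> A}.
Local Notation I := (@id_ser K B).

Definition smap (f : A -> B) (F : ser B A) : ser B B := fun s => f (F s).

Definition slift (F : ser B B) : ser B A := fun s => iota (F s).

Lemma sliftD F G : slift (F + G) = slift F + slift G.
Proof. by apply: funext => s; rewrite /slift serD rmorphD. Qed.

Lemma sliftM F G : slift (F * G) = slift F * slift G.
Proof.
apply: funext => s; rewrite /slift !serM rmorph_sum.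
by apply: eq_bigr => k _; rewrite rmorphM.
Qed.

Lemma slift1 : slift 1 = 1.
Proof. by apply: funext => -[|b s]; rewrite /slift ser1E ?rmorph1 ?rmorph0. Qed.

(* The series (1 - I x)^-1; its image under f is the moment series of x with
   the last argument removed. *)
Definition words (x : A) : ser B A := fun s => \prod_(b <- s) (iota b * x).

Lemma slift_idM F b s : (slift I * F) (b :: s) = iota b * F s.
Proof.
rewrite serM_cons /slift rmorph0 mul0r add0r.
have -> : shift (fun s => iota (I s)) b = ser_cst (iota b).
  by apply: funext => -[|c t]; rewrite /shift //= rmorph0.
by rewrite ser_cstMl.
Qed.

Lemma slift_idM_nil F : (slift I * F) [::] = 0.
Proof. by rewrite serM_nil /slift rmorph0 mul0r. Qed.

Lemma words_fix x : words x = 1 + slift I * ser_cst x * words x.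
Proof.
apply: funext => -[|b s]; rewrite serD -mulrA.
  by rewrite slift_idM_nil addr0 /words big_nil.
by rewrite slift_idM ser_cstMl add0r mulrA /words big_cons.
Qed.

Lemma words_invl x : (1 - slift I * ser_cst x) * words x = 1.
Proof. by rewrite mulrBl mul1r {1}words_fix addrK. Qed.

Lemma words_invr x : words x * (1 - slift I * ser_cst x) = 1.
Proof.
apply: ser_invC (words_invl x).
by rewrite serB slift_idM_nil subr0.
Qed.

Section BimoduleMap.
Variable f : {linear A -> B}.
Hypothesis f_bimod : unital_bimodule_map iota f.

Lemma bimodl b x : f (iota b * x) = b * f x.
Proof. by case: f_bimod => _ /(_ b x 1); rewrite rmorph1 !mulr1. Qed.

Lemma bimodr b x : f (x * iota b) = f x * b.
Proof. by case: f_bimod => _ /(_ 1 x b); rewrite rmorph1 !mul1r. Qed.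

Lemma bimod_iota b : f (iota b) = b.
Proof. by case: f_bimod => f1 _; rewrite -[iota b]mulr1 bimodl f1 mulr1. Qed.

Lemma smapD F G : smap f (F + G) = smap f F + smap f G.
Proof. by apply: funext => s; rewrite /smap !serD raddfD. Qed.

Lemma smapB F G : smap f (F - G) = smap f F - smap f G.
Proof. by apply: funext => s; rewrite /smap !serB raddfB. Qed.

Lemma smapMl F G : smap f (slift F * G) = F * smap f G.
Proof.
apply: funext => s; rewrite /smap !serM raddf_sum.
by apply: eq_bigr => k _; apply: bimodl.
Qed.

Lemma smapMr F G : smap f (G * slift F) = smap f G * F.
Proof.
apply: funext => s; rewrite /smap !serM raddf_sum.
by apply: eq_bigr => k _; apply: bimodr.
Qed.

Lemma smap_slift F : smap f (slift F) = F.
Proof. by apply: funext => s; rewrite /smap /slift bimod_iota. Qed.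

Lemma smap1 : smap f 1 = 1.
Proof. by rewrite -slift1 smap_slift. Qed.

Definition moments x : ser B B := smap f (words x).

Lemma moments_nil x : moments x [::] = 1.
Proof. by rewrite /moments /smap /words big_nil; case: f_bimod. Qed.

Lemma moment_seriesE x : (moment_series iota f x : ser B B) = moments x * I.
Proof.
pose W s := if s is b :: t then iota b * \prod_(c <- t) (x * iota c) else 0.
have -> : moment_series iota f x = smap f W.
  by apply: funext => -[|b s]; rewrite /smap /= ?raddf0.
rewrite -smapMr; congr (smap f _); apply: funext; elim=> [|b s IHs].
  by rewrite serM_nil /slift rmorph0 mulr0.
rewrite words_fix mulrDl mul1r -!mulrA serD slift_idM ser_cstMl -IHs.
case: s {IHs} => [|c s] /=; first by rewrite big_nil mulr0 mulr1 mulr0 addr0.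
by rewrite big_cons !mulrA /slift rmorph0 add0r.
Qed.

(** The moment series is [moments x * I], and the trailing [I] cancels on the right. The result
    exhibits [H] as a Boolean cumulant series. *)
Lemma moments_fix (H : ser B B) x :
    (moment_series iota f x : ser B B) =
      I + I * (H * (moment_series iota f x : ser B B)) ->
  moments x = 1 + I * H * moments x.
Proof.
move=> eqC; apply: id_ser_mulIr; rewrite mulrDl mul1r -!mulrA.
by rewrite -moment_seriesE.
Qed.

(** Substituting [alpha] for [I] in [(1 - I x)^-1] gives [(1 - alpha x)^-1], which is [N]; [f]
    commutes with the substitution by additivity. *)
Lemma ser_comp_smap_words (N : ser B A) (alpha : ser B B) x : alpha [::] = 0 ->
    N = 1 + slift alpha * ser_cst x * N ->
  ser_comp (moments x) alpha = smap f N.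
Proof.
move=> alpha0 eqN.
transitivity (smap f (ser_comp (words x) alpha)).
  by apply: funext => s; rewrite /ser_comp /smap raddf_sum.
congr (smap f _).
apply: (@ser_fixpoint_unique _ _ (slift alpha * ser_cst x) 1) eqN.
  by rewrite serM_nil /slift alpha0 rmorph0 mul0r.
rewrite [in LHS]words_fix ser_compD ser_comp1 !ser_compM ser_comp_cst; congr (1 + _ * _ * _).
rewrite -[in RHS](ser_comp_id_ser alpha0).
by apply: funext => s; rewrite /ser_comp /slift rmorph_sum.
Qed.

End BimoduleMap.

Lemma are_H_transforms_moments phi psi x Hx Hcx :
    unital_bimodule_map iota phi -> unital_bimodule_map iota psi ->
    are_H_transforms iota phi psi x Hx Hcx ->
  moments psi x = 1 + I * (Hx : ser B B) * moments psi x /\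
  moments phi x = 1 + I * (Hcx : ser B B) * moments phi x.
Proof.
move=> phib psib [Kx [Kcx [Tx [Tcx [[[_ eqK] [_ eqKc]] [TK TKc] [HT HTc]]]]]].
move/funext: eqK => eqK; move/funext: eqKc => eqKc.
rewrite scompE in eqK; rewrite scompE in eqKc.
split; apply: moments_fix => //.
  by rewrite [Hx](H_series_cumulants eqK TK TK HT HT).
by rewrite [Hcx](H_series_cumulants eqK TK TKc HT HTc).
Qed.

End Moments.

(** * Conditional monotone independence *)

Section Independence.
Variables (K : comNzRingType) (A B : algType K).
Variable iota : {lrmorphism B -> A}.
Implicit Types (x u v t : A).

Lemma bimod_alg0 x : bimod_alg iota x 0.
Proof.
rewrite -[0](addNr x) -scaleN1r.
by apply: bimod_alg_lin; apply: bimod_alg_gen.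
Qed.

Lemma bimod_alg_add x u v :
  bimod_alg iota x u -> bimod_alg iota x v -> bimod_alg iota x (u + v).
Proof. by move=> xu xv; rewrite -[u]scale1r; apply: bimod_alg_lin. Qed.

Lemma bimod_alg_actl x b u : bimod_alg iota x u -> bimod_alg iota x (iota b * u).
Proof. by move=> /(bimod_alg_act b 1); rewrite rmorph1 mulr1. Qed.

Lemma bimod_alg_actr x b u : bimod_alg iota x u -> bimod_alg iota x (u * iota b).
Proof. by move=> /(bimod_alg_act 1 b); rewrite rmorph1 mul1r. Qed.

(** The sum of [B] and the non-unital algebra generated by [x]. Coefficients of geometric series lie
    here, whereas independence speaks of the second summand only. *)
Definition unital_alg x u := exists b v, bimod_alg iota x v /\ u = iota b + v.

Lemma unital_alg_iota x b : unital_alg x (iota b).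
Proof. by exists b, 0; split; [exact: bimod_alg0 | rewrite addr0]. Qed.

Lemma unital_alg_bimod x u : bimod_alg iota x u -> unital_alg x u.
Proof. by move=> xu; exists 0, u; rewrite rmorph0 add0r. Qed.

Lemma unital_alg_add x u v :
  unital_alg x u -> unital_alg x v -> unital_alg x (u + v).
Proof.
move=> [b [u' [xu ->]]] [c [v' [xv ->]]]; exists (b + c), (u' + v').
by rewrite rmorphD addrACA; split; first exact: bimod_alg_add.
Qed.

Lemma unital_alg_mul x u v :
  unital_alg x u -> unital_alg x v -> unital_alg x (u * v).
Proof.
move=> [b [u' [xu ->]]] [c [v' [xv ->]]].
exists (b * c), (iota b * v' + (u' * iota c + u' * v')); split.
  apply: bimod_alg_add; first exact: bimod_alg_actl.
  by apply: bimod_alg_add; [apply: bimod_alg_actr | apply: bimod_alg_mul].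
by rewrite rmorphM mulrDl !mulrDr -addrA.
Qed.

Lemma unital_alg_words x s : unital_alg (x - 1) (words iota x s).
Proof.
rewrite /words; elim/big_rec: _ => [|b u _ xu].
  by rewrite -(rmorph1 iota); apply: unital_alg_iota.
apply: unital_alg_mul xu; apply: unital_alg_mul; first exact: unital_alg_iota.
exists 1, (x - 1); split; first exact: bimod_alg_gen.
by rewrite rmorph1 addrC subrK.
Qed.

Section Alternating.
Variables a b : A.
Local Notation gen i := (if i then b - 1 else a - 1).
Local Notation altw := (alternating_word iota a b).

(** The span of alternating words whose first letter has index [i]. Closure under sums suffices,
    because scalars are absorbed by the first letter. *)
Inductive alternating (i : bool) : A -> Prop :=
| alternating_word_prod p w :
    altw ((i, p) :: w) -> alternating i (wprod ((i, p) :: w))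
| alternating_add u v :
    alternating i u -> alternating i v -> alternating i (u + v).

Lemma wprod_cons i p (w : seq (bool * A)) : wprod ((i, p) :: w) = p * wprod w.
Proof. by rewrite /wprod big_cons. Qed.

Lemma wprod_nil : wprod [::] = 1 :> A.
Proof. by rewrite /wprod big_nil. Qed.

Lemma alternating_letter i u :
  bimod_alg iota (gen i) u -> alternating i u.
Proof.
move=> iu; rewrite -[u]mulr1 -wprod_nil -(wprod_cons i).
by apply: alternating_word_prod; split=> // _ /[1!inE] /eqP->.
Qed.

Lemma alternating_word_head i p q w : bimod_alg iota (gen i) q ->
  altw ((i, p) :: w) -> altw ((i, q) :: w).
Proof.
move=> iq [sw mw]; split; first by case: w sw {mw}.
by move=> u /[1!inE] /predU1P[->|uw] //; apply: mw; rewrite inE uw orbT.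
Qed.

Lemma alternating_act i c t : alternating i t -> alternating i (iota c * t).
Proof.
elim=> [p w aw|u v _ iu _ iv]; last by rewrite mulrDr; apply: alternating_add.
rewrite wprod_cons mulrA -(wprod_cons i); apply: alternating_word_prod.
apply: alternating_word_head (aw); apply: bimod_alg_actl.
by case: aw => _ /(_ (i, p)); apply; rewrite mem_head.
Qed.

(** A new letter merges with a first letter of the same index and is prepended to one of the other
    index. *)
Lemma alternating_mul i j u t :
  bimod_alg iota (gen i) u -> alternating j t -> alternating i (u * t).
Proof.
move=> iu; elim=> [p w aw|v v' _ jv _ jv']; last first.
  by rewrite mulrDr; apply: alternating_add.
have [sw mw] := aw.
have [eqij|neqij] := eqVneq i j.
  rewrite wprod_cons mulrA -(wprod_cons i); apply: alternating_word_prod.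
  rewrite -eqij in aw mw *; apply: alternating_word_head (aw); apply: bimod_alg_mul => //.
  by apply: (mw (i, p)); rewrite mem_head.
rewrite -(wprod_cons i); apply: alternating_word_prod; split; first exact/andP.
by move=> v /[1!inE] /predU1P[->|/mw].
Qed.

(* With [a' = a - 1] and [b' = b - 1], every product of factors [c b a] is a
   combination of scalars and alternating words. *)
Lemma alternating_words s :
  exists c u v, [/\ alternating false u, alternating true v
                  & words iota (b * a) s = iota c + u + v].
Proof.
pose P t := exists c u v, [/\ alternating false u, alternating true v
                            & t = iota c + u + v].
have alt0 i : alternating i 0 by apply/alternating_letter/bimod_alg0.
have PD t t' : P t -> P t' -> P (t + t').
  move=> [c [u [v [fu tv ->]]]] [c' [u' [v' [fu' tv' ->]]]].
  exists (c + c'), (u + u'), (v + v'); split; try exact: alternating_add.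
  by rewrite rmorphD addrACA; congr (_ + _); rewrite addrACA.
have Pact c t : P t -> P (iota c * t).
  move=> [d [u [v [fu tv ->]]]]; exists (c * d), (iota c * u), (iota c * v).
  by rewrite !mulrDr rmorphM; split=> //; apply: alternating_act.
have Pgen i t : P t -> P (gen i * t).
  move=> [d [u [v [fu tv ->]]]].
  have alti : alternating i (gen i * (iota d + u + v)).
    rewrite !mulrDr; have gi := bimod_alg_gen iota (gen i).
    apply: alternating_add; last exact: alternating_mul tv.
    apply: alternating_add; last exact: alternating_mul fu.
    exact/alternating_letter/bimod_alg_actr.
  exists 0; case: i alti => alti; [exists 0, (gen true * (iota d + u + v))
    | exists (gen false * (iota d + u + v)), 0]; rewrite rmorph0 ?add0r ?addr0.
    by split.
  by split.
have Pmul i t : P t -> P ((if i then b else a) * t).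
  move=> Pt; have -> : (if i then b else a) * t = t + gen i * t.
    by case: i; rewrite mulrBl mul1r addrC subrK.
  exact/PD/Pgen.
rewrite /words; elim/big_rec: _ => [|c u _ Pu].
  by exists 1, 0, 0; rewrite rmorph1 !addr0.
by rewrite -!mulrA; apply/Pact/(Pmul true)/(Pmul false).
Qed.

(** * Factorization at centred letters *)

Variables phi psi : {linear A -> B}.
Hypothesis phi_bimod : unital_bimodule_map iota phi.
Hypothesis psi_bimod : unital_bimodule_map iota psi.
Hypothesis indep : cmonotone_indep iota phi psi a b.

(* Both functionals factorize at a psi-centred letter from <b>_0; this single
   rule covers all the defining relations of conditional monotone independence. *)
Definition cut_rule (f : A -> B) := forall s p w, altw (s ++ (true, p) :: w) ->
  f (wprod s * (p - iota (psi p)) * wprod w) =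
  f (wprod s) * f (p - iota (psi p)) * f (wprod w).

(** Both sides vanish: the left by monotone independence, the right because [p - psi p] is centred
    for [psi]. *)
Lemma cut_rule_psi : cut_rule psi.
Proof.
case: indep => mono _ _ _ s p w /mono eqp.
rewrite mulrBr mulrBl !raddfB /= eqp subrr bimod_iota // subrr.
by rewrite mulr0 mul0r.
Qed.

(** The three relations for [phi] cover an empty prefix, an empty suffix, and the case where both
    are nonempty. *)
Lemma cut_rule_phi : cut_rule phi.
Proof.
case: indep => _ first last inner s p w spw.
rewrite mulrBr mulrBl !raddfB /= (bimod_iota phi_bimod).
have [s0|s0] := eqVneq s [::].
  rewrite s0 in spw *; rewrite wprod_nil !mul1r first // bimodl //.
  by case: phi_bimod => -> _; rewrite mul1r mulrBl.
have [w0|w0] := eqVneq w [::].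
  rewrite w0 cats1 in spw; rewrite w0 wprod_nil !mulr1 last // bimodr //.
  by case: phi_bimod => -> _; rewrite mulr1 mulrBr.
by rewrite inner // addrK.
Qed.

Section Cut.
Variable f : {linear A -> B}.
Hypothesis f_bimod : unital_bimodule_map iota f.
Hypothesis f_cut : cut_rule f.

(** What may follow a letter of index 2: a scalar plus words starting with index 1. *)
Definition right_factor t :=
  exists c u, alternating false u /\ t = iota c + u.

(** The factorization is additive in the outer factors, so scalar parts and word parts are treated
    separately. *)
Lemma cut_unital u p t :
    unital_alg (a - 1) u -> unital_alg (b - 1) p -> right_factor t ->
  f (u * (p - iota (psi p)) * t) = f u * f (p - iota (psi p)) * f t.
Proof.
move=> [d [u' [au ->]]] [c [p' [bp ->]]] [e [t' [ft ->]]].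
(* Centring removes the scalar part of [p], which leaves a genuine letter. *)
have -> : iota c + p' - iota (psi (iota c + p')) = p' - iota (psi p').
  by rewrite raddfD /= bimod_iota // rmorphD [iota c + p']addrC addrKA.
set q := p' - _.
pose P v w := f (v * q * w) = f v * f q * f w.
have PDl v1 v2 w : P v1 w -> P v2 w -> P (v1 + v2) w.
  by rewrite /P !mulrDl !raddfD /= !mulrDl => -> ->.
have PDr v w1 w2 : P v w1 -> P v w2 -> P v (w1 + w2).
  by rewrite /P !mulrDr !raddfD /= !mulrDr => -> ->.
have Pl c' w : P 1 w -> P (iota c') w.
  rewrite /P -!mulrA bimodl // mul1r => ->.
  by case: f_bimod => -> _; rewrite bimod_iota // mul1r !mulrA.
have Pr c' v : P v 1 -> P v (iota c').
  rewrite /P bimodr // mulr1 => ->.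
  by case: f_bimod => -> _; rewrite bimod_iota // mulr1.
have Pw s : altw (rcons s (true, p')) -> P (wprod s) 1 /\
    forall v, alternating false v -> P (wprod s) v.
  move=> [ss ms]; split.
    by rewrite -wprod_nil; apply: f_cut; rewrite cats1.
  move=> v; elim=> {v} [r w [sw mw]|t1 t2 _ Pt1 _ Pt2]; last exact: PDr.
  apply: f_cut; split; first by rewrite sorted_cat_cons ss.
  move=> v; rewrite mem_cat in_cons orbA => /orP[|/mw //].
  by move=> /orP sv; apply: ms; rewrite mem_rcons in_cons orbC; apply/orP.
have [] := Pw [::]; first by split=> // _ /[1!inE] /eqP->.
rewrite wprod_nil => P11 P1t.
have [] := Pw [:: (false, u')].
  by split=> // v; rewrite !inE => /orP[] /eqP->.
rewrite wprod_cons wprod_nil mulr1 => Pu1 Put.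
apply: PDl; apply: PDr.
- exact/Pl/Pr.
- exact/Pl/P1t.
- exact/Pr.
- exact: Put.
Qed.

Lemma smap_cut (X V Y : ser B A) :
    (forall s, unital_alg (a - 1) (X s)) ->
    (forall s, unital_alg (b - 1) (V s)) ->
    (forall s, right_factor (Y s)) ->
  smap f (X * (V - slift iota (smap psi V)) * Y) =
  smap f X * smap f (V - slift iota (smap psi V)) * smap f Y.
Proof.
move=> aX bV rY; apply: funext => s; rewrite /smap !serM raddf_sum.
apply: eq_bigr => k _; rewrite !serM !mulr_suml raddf_sum.
by apply: eq_bigr => j _; apply: cut_unital.
Qed.

End Cut.

(** * The product formula *)

Local Notation I := (@id_ser K B).
Local Notation j := (slift iota).

(** Here [f] stands for [phi] or [psi]. The inner series [Hb] always comes from [psi], since the cut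
    rule centres with [psi]. *)
Lemma H_product (f : {linear A -> B}) (Hb Hfa Hfb Hfba : ser B B) :
    unital_bimodule_map iota f -> cut_rule f -> Hb [::] = 1 ->
    moments iota psi b = 1 + I * Hb * moments iota psi b ->
    moments iota f a = 1 + I * Hfa * moments iota f a ->
    moments iota f b = 1 + I * Hfb * moments iota f b ->
    moments iota f (b * a) = 1 + I * Hfba * moments iota f (b * a) ->
  Hfba = Hfb * ser_comp Hfa (I * Hb).
Proof.
move=> f_bimod f_cut Hb1 eq_Hb eq_Hfa eq_Hfb eq_Hfba.
set eta := ser_comp _ _.
pose a' : ser B A := ser_cst (a - 1).
pose V := words iota b - 1; pose Z := smap psi V; pose Zf := smap f V.
pose U := words iota (b * a); pose Y := 1 + a' * U.
set Mb := moments iota psi b in eq_Hb; set Mf := moments iota f b in eq_Hfb.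
set m := moments iota f (b * a) in eq_Hfba.
have ZE : Z = Mb - 1 by rewrite /Z smapB (smap1 psi_bimod).
have ZfE : Zf = Mf - 1 by rewrite /Zf smapB (smap1 f_bimod).
have MbE : Mb = 1 + Z by rewrite ZE addrC subrK.
have jMb : j Mb = 1 + j Z.
  by rewrite -(slift1 iota) -sliftD -MbE.
have Mb1 : Mb [::] = 1 by apply: moments_nil.
have m1 : m [::] = 1 by apply: moments_nil.
have Z0 : Z [::] = 0 by rewrite ZE serB Mb1 subrr.
have jZ0 : (j Z * a') [::] = 0 by rewrite serM_nil /slift Z0 rmorph0 mul0r.
have I0 F : (I * F) [::] = 0 := id_serM_nil F.
have inv0 (F : ser B B) : F [::] = 0 -> (1 - F) [::] = 1.
  by move=> F0; rewrite serB F0 subr0.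
(* From [b a = b + b a'] one gets [(1 - I b) U = 1 + I b a' U]; multiply by [W_b] on the left and
   use [V = W_b I b]. *)
have eqU : U = 1 + V * Y.
  have aE : ser_cst a = 1 + a' :> ser B A by rewrite /a' ser_cstB1 addrC subrK.
  have VE : V = words iota b * (j I * ser_cst b).
    have := words_invr iota b; rewrite mulrBr mulr1 => /eqP.
    by rewrite subr_eq addrC -subr_eq => /eqP.
  have : (1 - j I * ser_cst b) * U = 1 + j I * ser_cst b * (a' * U).
    rewrite mulrBl mul1r; set X := j I * ser_cst b.
    have {1}-> : U = 1 + X * U + X * (a' * U).
      rewrite {1}/U words_fix ser_cstM aE -/U -addrA mulrA -/X.
      by rewrite mulrDr mulr1 mulrDl -mulrA.
    by rewrite addrAC addrK.
  move/(congr1 (fun F => words iota b * F)).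
  rewrite /= (mulrA (words iota b) _ U) words_invr mul1r mulrDr mulr1.
  rewrite (mulrA (words iota b) _ (a' * U)) -VE => ->.
  by rewrite /Y mulrDr mulr1 addrA [1 + V]addrC subrK.
have [S invS] : {S | (1 - j Z * a') * S = 1}.
  by apply: ser_right_inverse; rewrite serB jZ0 subr0.
have SinvS : S * (1 - j Z * a') = 1.
  by apply: ser_invC invS; rewrite serB jZ0 subr0.
have eqS : S = 1 + j Z * a' * S.
  by apply/eqP; rewrite -subr_eq -{1}[S]mul1r -mulrBl invS.
pose V0 := V - j Z.
have a1 s : unital_alg (a - 1) ((1 : ser B A) s).
  by rewrite -(slift1 iota); apply: unital_alg_iota.
(* Induction on the degree: [j Z * a'] has no constant term, so the fixed-point equation only calls
   [S] on shorter lists. *)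
have aS s : unital_alg (a - 1) (S s).
  have [n] := ubnP (size s); elim: n s => // n IHn s; rewrite ltnS => lesn.
  rewrite eqS serD -mulrA serM big_ord_recl take0 /slift Z0 rmorph0 mul0r add0r.
  elim/big_rec: _ => [|k u _ au]; first by rewrite addr0.
  rewrite addrCA; apply: unital_alg_add => //.
  apply: unital_alg_mul; first exact: unital_alg_iota.
  rewrite ser_cstMl; apply: unital_alg_mul.
    exact/unital_alg_bimod/bimod_alg_gen.
  apply: IHn; rewrite size_drop; apply: leq_trans lesn.
  by case: (size s) k => [[]|l k] //; rewrite subSS ltnS leq_subr.
have bV s : unital_alg (b - 1) (V s).
  rewrite /V serB; apply: unital_alg_add; first exact: unital_alg_words.
  by rewrite -(slift1 iota) /slift -rmorphN; apply: unital_alg_iota.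
(* Left multiplication by [a - 1] makes every word start with index 1. *)
have rY s : right_factor (Y s).
  have [c [u [v [fu tv eqw]]]] := alternating_words s.
  exists ((1 : ser B B) s), ((a - 1) * U s); split; last first.
    by rewrite /Y serD ser_cstMl -(slift1 iota).
  have ga := bimod_alg_gen iota (a - 1).
  rewrite /U eqw !mulrDr; apply: alternating_add.
    apply: alternating_add; last exact: (alternating_mul (i := false)) fu.
    by apply: alternating_letter; apply: bimod_alg_actr.
  exact: (alternating_mul (i := false)) tv.
set y := smap f Y.
have V0E : smap f V0 = Zf - Z by rewrite /V0 smapB (smap_slift f_bimod).
have VV0 : V = V0 + j Z by rewrite /V0 subrK.
(* First equation for [m] and [y]: the cut with left factor 1. *)
have eq_m : m = 1 + Zf * y.
  rewrite /m /moments -/U eqU smapD (smap1 f_bimod); congr (1 + _).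
  have VY : smap f (V0 * Y) = smap f V0 * y.
    have := smap_cut f_bimod f_cut (X := 1) a1 bV rY.
    by rewrite (smap1 f_bimod) !mul1r.
  by rewrite VV0 mulrDl smapD VY (smapMl f_bimod) V0E -mulrDl subrK.
pose N := S * j Mb.
(* Move [j Z * Y] to the left in [U = 1 + (V0 + j Z) Y], replace [Y - 1] by [a' * U], and multiply
   by [S]. *)
have eqUS : U = N + S * V0 * Y.
  have : (1 - j Z * a') * U = j Mb + V0 * Y.
    have -> : (1 - j Z * a') * U = U - j Z * (Y - 1).
      by rewrite mulrBl mul1r /Y [1 + _]addrC addrK mulrA.
    rewrite eqU {1}VV0 mulrDl mulrBr mulr1 opprB -addrA.
    rewrite -(addrA (V0 * Y)) [j Z * Y + _]addrC subrK.
    by rewrite jMb -addrA [V0 * Y + _]addrC.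
  move/(congr1 (fun F => S * F)).
  by rewrite mulrA SinvS mul1r mulrDr mulrA.
(* Second equation: the cut with left factor [S]. *)
have eq_m' : m = smap f N + smap f S * (Zf - Z) * y.
  rewrite /m /moments -/U eqUS smapD (smap_cut f_bimod f_cut aS bV rY).
  by rewrite -/V0 V0E.
pose g := I * Hb.
have g0 : g [::] = 0 by apply: I0.
have Mbg : Mb * (1 - g) = 1.
  apply: ser_invC; first exact: inv0.
  by rewrite mulrBl mul1r {1}eq_Hb addrK.
have Zg : Z = Mb * g.
  by rewrite ZE; move/eqP: Mbg; rewrite mulrBr mulr1 subr_eq addrC -subr_eq => /eqP.
(* [Mb = (1 - g)^-1] and [Z = Mb g] give [Mb (1 - g a) = 1 - Z a'], hence [N = (1 - g a)^-1]. *)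
have eqN : N = 1 + j g * ser_cst a * N.
  have : j Mb * (1 - j g * ser_cst a) * N = j Mb * 1.
    have -> : j Mb * (1 - j g * ser_cst a) = 1 - j Z * a'.
      rewrite mulrBr mulr1 (mulrA (j Mb)) -sliftM -Zg jMb.
      by rewrite /a' ser_cstB1 mulrBr mulr1 opprB addrA.
    by rewrite /N mulrA invS mul1r mulr1.
  rewrite -mulrA => /ser_mulIl H.
  have : (1 - j g * ser_cst a) * N = 1.
    by apply: H; rewrite /slift Mb1 rmorph1.
  by rewrite mulrBl mul1r => /eqP; rewrite subr_eq => /eqP.
have eqn : smap f N = 1 + g * eta * smap f N.
  rewrite -(ser_comp_smap_words f g0 eqN) {1}eq_Hfa.
  by rewrite ser_compD !ser_compM ser_comp1 ser_comp_id_ser.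
have nE : smap f N = smap f S * Mb by rewrite /N (smapMr f_bimod).
(* The first equation turns [Zf * y] into [m - 1] in the second, so [m = f(S) (m - Z y + Z)]; and
   [Mb (1 - g eta)] inverts [f(S)]. *)
have key : Mb * (1 - g * eta) * m = m - Z * y + Z.
  have n1 : (smap f N) [::] = 1.
    by rewrite eqn serD -mulrA serM_nil g0 mul0r addr0.
  have S1 : (smap f S) [::] = 1.
    by move: n1; rewrite nE serM_nil Mb1 mulr1.
  have invN : smap f N * (1 - g * eta) = 1.
    apply: ser_invC; first by apply: inv0; rewrite serM_nil g0 mul0r.
    by rewrite mulrBl mul1r {1}eqn addrK.
  have {1}-> : m = smap f S * (m - Z * y + Z).
    rewrite {1}eq_m' nE -(mulrA (smap f S)) -mulrDr; congr (_ * _).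
    rewrite mulrBl [X in X - Z * y + Z]eq_m.
    by rewrite MbE -addrA [Z + _]addrC !addrA.
  rewrite mulrA.
  have -> : Mb * (1 - g * eta) * smap f S = 1.
    by apply: ser_invC S1 _; rewrite mulrA -nE.
  by rewrite mul1r.
(* With [Mb * g = Z], [key] reads [Z y = Z w]. Here [Z = I (Hb Mb)] cancels on the left, as [Hb Mb]
   has constant term 1. *)
pose w := 1 - m + eta * m.
have eqy : y = w.
  have : Z * y = Z * w.
    move: key; rewrite mulrBr mulr1 (mulrA Mb) -Zg MbE.
    rewrite mulrBl mulrDl mul1r -!addrA => /addrI keyZ.
    have -> : Z * y = Z - (- (Z * y) + Z) by rewrite opprD opprK addrCA subrr addr0.
    by rewrite -keyZ /w opprB mulrDr mulrBr mulr1 mulrA addrA addrAC.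
  have -> : Z = I * (Hb * Mb) by rewrite ZE {1}eq_Hb addrC addKr mulrA.
  rewrite -!(mulrA I) => /id_ser_mulIl; apply: ser_mulIl.
  by rewrite serM_nil Hb1 Mb1 mulr1.
pose h := I * Hfb.
(* Multiply the first equation by [1 - h], which sends [Zf] to [h], and insert [y = w]; the two
   terms [- h m] cancel. *)
have eqm : m = 1 + h * eta * m.
  have hMf : (1 - h) * Mf = 1 by rewrite mulrBl mul1r {1}eq_Hfb addrK.
  have hZf : (1 - h) * Zf = h by rewrite ZfE mulrBr mulr1 hMf subKr.
  have : (1 - h) * m = 1 - h * m + h * eta * m.
    rewrite {1}eq_m mulrDr mulr1 mulrA hZf eqy /w mulrDr mulrBr mulr1.
    by rewrite !addrA subrK mulrA.
  by rewrite mulrBl mul1r addrAC => /addIr.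
apply/id_ser_mulIl/(ser_mulIr m1); rewrite mulrA -/h.
by apply: (addrI 1); rewrite -eqm -eq_Hfba.
Qed.

End Alternating.
End Independence.

Unset Implicit Arguments.

Theorem theorem5p2p7
  (R : realType) (A B : algType (complex R))
  (iota : {lrmorphism B -> A}) (phi psi : {linear A -> B})
  (iota_inj : injective iota)
  (phi_bimod : unital_bimodule_map iota phi)
  (psi_bimod : unital_bimodule_map iota psi)
  (a b : A)
  (ab_indep : cmonotone_indep iota phi psi a b)
  (phi_a : phi a = 1) (psi_a : psi a = 1)
  (phi_b : phi b = 1) (psi_b : psi b = 1)
  (Ha Hca Hb Hcb Hba Hcba : mseries B)
  (Ha_def : are_H_transforms iota phi psi a Ha Hca)
  (Hb_def : are_H_transforms iota phi psi b Hb Hcb)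
  (Hba_def : are_H_transforms iota phi psi (b * a) Hba Hcba) :
  Hba =1 cauchy Hb (scomp Ha (cauchy sI Hb)) /\
  Hcba =1 cauchy Hcb (scomp Hca (cauchy sI Hb)).
Proof.
have Hb1 : Hb [::] = 1 by case: Hb_def => ? [? [? [? [_ _ [[[_ ]]]]]]].
have [psi_a_fix phi_a_fix] := are_H_transforms_moments phi_bimod psi_bimod Ha_def.
have [psi_b_fix phi_b_fix] := are_H_transforms_moments phi_bimod psi_bimod Hb_def.
have [psi_ba_fix phi_ba_fix] :=
  are_H_transforms_moments phi_bimod psi_bimod Hba_def.
have psi_cut := cut_rule_psi psi_bimod ab_indep.
have phi_cut := cut_rule_phi phi_bimod ab_indep.
(* The same lemma is applied with [f = psi] and then with [f = phi]. *)
split=> s; rewrite scompE !cauchyE.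
  by rewrite [Hba](H_product psi_bimod psi_bimod psi_cut Hb1 psi_b_fix
    psi_a_fix psi_b_fix psi_ba_fix).
by rewrite [Hcba](H_product psi_bimod phi_bimod phi_cut Hb1 psi_b_fix
  phi_a_fix phi_b_fix phi_ba_fix).
Qed.
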